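(* Let $r_1,\varphi_0$ be constants with $r_1\neq0$, and put $R_2=\sqrt{n^2+\frac{\varphi_0^2}{r_1^2}}$. The geodesics for metrics of self-dual Taub-NUT type with constant $\theta=\frac{\pi}{2}$ and constant $\tau$, with conditions $$\lim_{r\to R_2}t=t_1,\quad \lim_{r\to R_2}\varphi=\varphi_1,\quad \lim_{r\to R_2}(r^2-n^2)\frac{d\varphi}{dt}=\varphi_0,\quad \lim_{r\to R_2}\left[\frac{r+n}{r-n}\left(\frac{dr}{dt}\right)^2+\frac{\varphi_0^2}{r^2-n^2}\right]=r_1^2,$$ satisfy $$t(r)=t_1+\frac{\epsilon}{r_1}\left[\sqrt{r^2-R_2^2}+n\ln\left(r+\sqrt{r^2-R_2^2}\right)\right],$$ $$\varphi(r)=\varphi_1+\epsilon\arctan\frac{r_1(rn-R_2^2)}{\varphi_0\sqrt{r^2-R_2^2}},$$ where $\epsilon=\pm1$.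
   Context: The metric of self-dual Taub-NUT type with parameter $n$ is $$ds^2=\frac{r-n}{r+n}(d\tau+2n\cos\theta\, d\varphi)^2+(r^2-n^2)(d\theta^2+\sin^2\theta\, d\varphi^2)+\frac{r+n}{r-n}dr^2$$ in coordinates $(\tau,r,\theta,\varphi)$. Geodesics are solutions of the geodesic equations of this metric with parameter $t$; along them $t$ and $\varphi$ are expressed as functions of $r$. Here $t_1$ and $\varphi_1$ are constants.
   Formalization: As printed, the formulas do not tend to t_1 and φ_1 as r→R_2. The formal statement adds the missing constants: −n ln R_2 inside the bracket for t(r), and sgn(r_1 φ_0)·π/2 added to the arctan in φ(r); for φ_0=0, where the arctan quotient is undefined, it reads φ=φ_1. *)

(* Defs.v *)
From mathcomp Require Import all_boot all_order all_algebra.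
From mathcomp Require Import all_classical all_reals all_analysis.
Import Order.TTheory GRing.Theory Num.Theory.
Import numFieldNormedType.Exports.

Set Implicit Arguments.
Unset Strict Implicit.
Unset Printing Implicit Defensive.

Local Open Scope ring_scope.
Local Open Scope classical_set_scope.

Section Geodesics.
Variables (R : realType) (m : nat).
Implicit Types (g : 'rV[R]_m.+1 -> 'M[R]_m.+1) (p : 'rV[R]_m.+1).

(* [gpartial g i j l p] is the partial derivative of g_jl along x^i at p *)
Definition gpartial g (i j l : 'I_m.+1) p : R :=
  'D_(delta_mx 0 i) (fun y => g y j l) p.

(* Gamma^k_ij = 1/2 g^kl (d_i g_jl + d_j g_il - d_l g_ij) *)
Definition christoffel g (k i j : 'I_m.+1) p : R :=
  2^-1 * \sum_l invmx (g p) k l *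
    (gpartial g i j l p + gpartial g j i l p - gpartial g l i j p).

Definition curve_coord (x : R -> 'rV[R]_m.+1) (k : 'I_m.+1) : R -> R :=
  fun s => x s 0 k.

(* The parameter is not required to be the arc length. *)
Definition is_geodesic g (x : R -> 'rV[R]_m.+1) (J : set R) : Prop :=
  forall s, J s -> forall k,
    [/\ derivable (curve_coord x k) s 1,
        derivable (derive1 (curve_coord x k)) s 1 &
        derive1n 2 (curve_coord x k) s
          + \sum_i \sum_j christoffel g k i j (x s)
              * derive1 (curve_coord x i) s * derive1 (curve_coord x j) s = 0].

End Geodesics.

(* Coordinates (tau, r, theta, phi) are numbered 0, 1, 2, 3. *)
Definition itau : 'I_4 := @Ordinal 4 0 isT.
Definition irad : 'I_4 := @Ordinal 4 1 isT.
Definition itheta : 'I_4 := @Ordinal 4 2 isT.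
Definition iphi : 'I_4 := @Ordinal 4 3 isT.

Section TaubNUT.
Variable R : realType.

Definition dcoord (i : 'I_4) : 'rV[R]_4 := delta_mx 0 i.

(* Gram matrix of the symmetric square of the covector w *)
Definition sqform (w : 'rV[R]_4) : 'M[R]_4 := w^T *m w.

Definition taubNUT (n : R) (p : 'rV[R]_4) : 'M[R]_4 :=
  let r := p 0 irad in
  let theta := p 0 itheta in
  ((r - n) / (r + n)) *: sqform (dcoord itau + (2 * n * cos theta) *: dcoord iphi)
  + (r ^+ 2 - n ^+ 2) *:
      (sqform (dcoord itheta) + (sin theta ^+ 2) *: sqform (dcoord iphi))
  + ((r + n) / (r - n)) *: sqform (dcoord irad).

(* The points where the line element is defined and positive definite, with
   theta the polar angle; the sign of n is not restricted. *)
Definition taubNUT_chart (n : R) : set 'rV[R]_4 :=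
  [set p | n ^+ 2 < p 0 irad ^+ 2 /\ 0 < p 0 itheta < pi].

End TaubNUT.

(* Main.v *)
Require Import Defs.
From mathcomp Require Import all_boot all_order all_algebra.
From mathcomp Require Import all_classical all_reals all_analysis.
From mathcomp Require Import ring lra.
Import Order.TTheory GRing.Theory Num.Theory.
Import numFieldNormedType.Exports.
Local Open Scope ring_scope.
Local Open Scope classical_set_scope.

(** On the equator theta = pi/2 the metric is diagonal, and along a curve with
theta and tau constant only the r and phi components of the geodesic equations
carry information. They have two first integrals: since the metric does not
depend on phi, the angular momentum (r^2 - n^2) phi' is constant; and so is the
energy (r+n)/(r-n) r'^2 + (r^2 - n^2) phi'^2. The boundary conditions at R2 say
that their values are phi0 and r1^2 ([angular_momentum_cst], [energy_cst]).
Eliminating phi' gives the radial equation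
[[ (r' (r + n))^2 = r1^2 (r^2 - R2^2), ]]
so r can turn only where r^2 = R2^2.

The hypothesis that t is a function of r makes r injective on J. An injective
continuous function on an open interval has no interior minimum, so r never
takes the value R2 ([inj_no_interior_min]); when R2 = |n| the chart already
excludes that value. Hence r' (r + n) / sqrt (r^2 - R2^2) is a continuous
function whose square is the nonzero constant r1^2, and it equals epsilon r1
with one sign epsilon for the whole geodesic ([sqr_cst_sign]).

What remains is two quadratures ([equator_quadratures]):
[[ dt/dr = epsilon (r + n) / (r1 sqrt (r^2 - R2^2)),
   dphi/dr = epsilon phi0 / (r1 (r - n) sqrt (r^2 - R2^2)). ]]
The right-hand sides of the theorem are primitives of these, and the constants
of integration are found by letting r tend to R2, where the first primitive
tends to n ln R2 and the arctangent to - sg (r1 phi0) pi/2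
([cvg_time_primitive], [cvg_angle_primitive]).

The degenerate values are compatible with this. If phi0 = 0 the geodesic is
radial, phi is constant, and the arctangent term vanishes because its argument
is a quotient by 0, which is 0. If R2 = 0 then n = phi0 = 0, the space is flat,
and r may be negative; the logarithm then has coefficient 0. If R2 > 0 then r
is positive, because r is close to R2 somewhere and never vanishes. *)

Set Implicit Arguments.
Unset Strict Implicit.
Unset Printing Implicit Defensive.

(** * Calculus on intervals *)

Lemma is_derive0_cst (R : realType) (J : set R) (f : R -> R) :
  is_interval J -> (forall s, J s -> is_derive s 1 f 0) ->
  forall a b, J a -> J b -> f a = f b.
Proof.
move=> Jitv f'0 a b; wlog ab : a b / a < b => [wlg Ja Jb|Ja Jb].
  have [ab|ba|->//] := ltgtP a b; first exact: wlg.
  by apply/esym; exact: wlg.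
have abJ z : z \in `[a, b]%R -> J z.
  by rewrite in_itv/= => abz; exact: (Jitv a b).
have [||c _ /eqP] := @MVT R f (fun=> 0) a b ab.
- by move=> z zab; apply/f'0/abJ; exact: subset_itv_oo_cc.
- apply: derivable_within_continuous => z /abJ /f'0 zf.
  exact: ex_derive.
- by rewrite mul0r subr_eq0 => /eqP.
Qed.

Lemma derive_within_continuous (R : realType) (J : set R) (f df : R -> R) a b :
  is_interval J -> (forall s, J s -> is_derive s 1 f (df s)) -> J a -> J b ->
  {within `[a, b], continuous f}.
Proof.
move=> Jitv f' Ja Jb; apply: derivable_within_continuous => z.
by rewrite in_itv/= => /(Jitv a b Ja Jb)/f' ?; exact: ex_derive.
Qed.

Lemma interval_nonzero_gt0 (R : realType) (J : set R) (f df : R -> R) :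
  is_interval J -> (forall s, J s -> is_derive s 1 f (df s)) ->
  (forall s, J s -> f s != 0) ->
  forall a b, J a -> J b -> 0 < f a -> 0 < f b.
Proof.
move=> Jitv f' f0 a b Ja Jb fa; rewrite ltNge; apply/negP => fb.
have [c cJ fc] : exists2 c, J c & f c = 0.
  have [ab|/ltW ba] := leP a b.
  - have [|c] := @IVT R f a b 0 ab (derive_within_continuous Jitv f' Ja Jb).
      by rewrite ge_min fb orbT le_max ltW.
    by rewrite in_itv/= => /(Jitv a b Ja Jb); exists c.
  - have [|c] := @IVT R f b a 0 ba (derive_within_continuous Jitv f' Jb Ja).
      by rewrite ge_min fb le_max (ltW fa) orbT.
    by rewrite in_itv/= => /(Jitv b a Jb Ja); exists c.
by have := f0 c cJ; rewrite fc eqxx.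
Qed.

(** A function with constant nonzero square cannot switch between the two square
roots, since it would have to vanish in between. This is what makes the sign
epsilon the same along the whole geodesic. *)
Lemma sqr_cst_sign (R : realType) (J : set R) (f df : R -> R) (c : R) :
  is_interval J -> (forall s, J s -> is_derive s 1 f (df s)) -> c != 0 ->
  (forall s, J s -> f s ^+ 2 = c ^+ 2) ->
  exists e : R, (e = 1 \/ e = -1) /\ forall s, J s -> f s = e * c.
Proof.
move=> Jitv f' c0 fc.
have fE s : J s -> f s = c \/ f s = - c.
  by move/fc/eqP; rewrite eqf_sqr => /orP[]/eqP; [left|right].
have f0 s : J s -> f s / c != 0.
  by move=> /fE[]->; rewrite ?mulNr divff// oppr_eq0 oner_eq0.
have fc' s : J s -> is_derive s 1 (fun s => f s / c) (df s / c).
  move=> /f' ?; apply: is_derive_eq.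
  by rewrite scaler0 add0r/GRing.scale/= mulrC.
have [[a Ja fa]|nofa] := pselect (exists2 a, J a & f a = c).
  exists 1; split; first by left.
  move=> s Js; have [|fs] := fE s Js; first by rewrite mul1r.
  have := interval_nonzero_gt0 Jitv fc' f0 Ja Js.
  by rewrite fa fs mulNr divff// ltr01 oppr_gt0 ltr10 => /(_ isT).
exists (-1); split; first by right.
move=> s Js; have [fs|] := fE s Js; last by rewrite mulN1r.
by exfalso; apply: nofa; exists s.
Qed.

(** On both sides of an interior minimum the function takes all values slightly
above the minimum, so each of these is taken twice. *)
Lemma inj_no_interior_min (R : realType) (J : set R) (f df : R -> R) (m : R) :
  open J -> is_interval J -> (forall s, J s -> is_derive s 1 f (df s)) ->
  (forall s t, J s -> J t -> f s = f t -> s = t) ->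
  (forall s, J s -> m <= f s) -> forall s, J s -> m < f s.
Proof.
move=> Jo Jitv f' finj mf s Js; rewrite lt_neqAle mf// andbT; apply/eqP => ms.
have /nbhs_ballP[e /= e0 eJ] : nbhs s J by exact: open_nbhs_nbhs.
have Ja : J (s - e / 2).
  apply: eJ; rewrite /ball/= opprB addrC subrK gtr0_norm ?divr_gt0//.
  by rewrite ltr_pdivrMr// mulr_natr mulr2n ltrDl.
have Jb : J (s + e / 2).
  apply: eJ; rewrite /ball/= opprD addrA subrr sub0r normrN.
  rewrite gtr0_norm ?divr_gt0//.
  by rewrite ltr_pdivrMr// mulr_natr mulr2n ltrDl.
set a := s - e / 2 in Ja *; set b := s + e / 2 in Jb *.
have e20 : 0 < e / 2 by rewrite divr_gt0.
have as_ : a < s by rewrite /a; lra.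
have sb : s < b by rewrite /b; lra.
have gt_m t : J t -> t != s -> m < f t.
  move=> Jt ts; rewrite lt_neqAle mf// andbT; apply: contraNneq ts => mt.
  by apply/eqP/finj => //; rewrite -mt.
have ma : m < f a by apply: gt_m => //; rewrite lt_eqF.
have mb : m < f b by apply: gt_m => //; rewrite gt_eqF.
pose v := Num.min (f a) (f b).
have mv : m < v by rewrite lt_min ma.
have va : v <= f a by rewrite ge_min lexx.
have vb : v <= f b by rewrite ge_min lexx orbT.
have [|c] := @IVT R f a s v (ltW as_) (derive_within_continuous Jitv f' Ja Js).
  by rewrite ge_min le_max -ms (ltW mv) va orbT.
rewrite in_itv/= => /andP[ac cs] fc.
have [|d] := @IVT R f s b v (ltW sb) (derive_within_continuous Jitv f' Js Jb).
  by rewrite ge_min le_max -ms (ltW mv) vb orbT.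
rewrite in_itv/= => /andP[sd db] fd.
have cd : c = d.
  apply: finj; last by rewrite fc.
  - by apply: (Jitv a s) => //; rewrite ac.
  - by apply: (Jitv s b) => //; rewrite sd.
have csE : c = s by apply/eqP; rewrite eq_le cs cd sd.
by move: mv; rewrite -fc csE -ms ltxx.
Qed.

Lemma within_limit_point_proper (T : topologicalType) (A : set T) (a : T) :
  limit_point A a -> ProperFilter (within A a^').
Proof.
move=> lim_a; apply: Build_ProperFilter.
by move=> /lim_a[y [ya Ay]] /(_ ya Ay).
Qed.

(** Turns the behaviour of the arctangent at infinity, with the sign of the
argument, into its behaviour at 0. *)
Lemma atanV (R : realType) (u : R) : u != 0 ->
  atan u = Num.sg u * (pi / 2) - atan u^-1.
Proof.
wlog u0 : u / 0 < u => [wlg un0|_].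
  have [u0|u0|u0] := ltgtP u 0; last 2 first.
  - exact: wlg.
  - by rewrite u0 eqxx in un0.
  have := wlg (- u); rewrite oppr_gt0 oppr_eq0 => /(_ u0 un0).
  by rewrite sgrN invrN !atanN => H; lra.
rewrite gtr0_sg// mul1r.
have P := pi_gt0 R.
have v0 : 0 < atan u^-1 by rewrite -(atan0 R) lt_atan// invr_gt0.
have vpi := atan_ltpi2 u^-1.
rewrite -[RHS]tanK; last by rewrite in_itv/=; apply/andP; split; lra.
congr atan; rewrite /tan sinB cosB sin_pihalf cos_pihalf !mul0r !mul1r.
rewrite add0r subr0.
by rewrite -[LHS]invrK -{1}[u^-1]atanK /tan invf_div.
Qed.

(** Computes a directional derivative from the restriction to a line,
parametrized so that the base point has parameter b. *)
Lemma derive_along_line (R : realType) (V : normedModType R) (f : V -> R)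
    (v a : V) (F : R -> R) (b : R) :
  (forall h : R, f (h *: v + a) = F (h *: 1 + b)) -> 'D_v f a = 'D_1 F b.
Proof.
move=> fF; have fF0 : f a = F b by have := fF 0; rewrite !scale0r !add0r.
rewrite /derive (_ : (fun h : R => h^-1 *: ((f \o shift a) (h *: v) - f a)) =
  (fun h : R => h^-1 *: ((F \o shift b) (h *: 1) - F b)))//.
by apply/funext => h; rewrite /= fF fF0.
Qed.

(** * The metric on the equator and the geodesic equations *)

Lemma invmx_diag (F : fieldType) (m : nat) (d : 'rV[F]_m) :
  (forall i, d 0 i != 0) -> invmx (diag_mx d) = diag_mx (\row_i (d 0 i)^-1).
Proof.
move=> d0.
have dV : diag_mx d *m diag_mx (\row_i (d 0 i)^-1) = 1%:M.
  rewrite mulmx_diag -diag_const_mx; congr diag_mx; apply/rowP => i.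
  by rewrite !mxE divff.
have [Ud _] := mulmx1_unit dV.
by rewrite -[LHS]mulmx1 -dV mulmxA mulVmx// mul1mx.
Qed.

Lemma sum_coords (R : realType) (F : 'I_4 -> R) :
  \sum_i F i = F itau + F irad + F itheta + F iphi.
Proof.
rewrite !big_ord_recl big_ord0 addr0 !addrA.
by do ![congr (_ + _)]; congr F; exact: val_inj.
Qed.

Definition equator_metric {R : realType} (n r : R) : 'rV[R]_4 :=
  \row_k nth 0 [:: (r - n) / (r + n); (r + n) / (r - n);
                   r ^+ 2 - n ^+ 2; r ^+ 2 - n ^+ 2] k.

Lemma taubNUT_equator (R : realType) (n : R) (p : 'rV[R]_4) :
  p 0 itheta = pi / 2 -> taubNUT n p = diag_mx (equator_metric n (p 0 irad)).
Proof.
move=> pth; rewrite /taubNUT pth cos_pihalf sin_pihalf mulr0 scale0r addr0.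
rewrite expr1n scale1r; apply/matrixP => i j.
rewrite !mxE !big_ord1 !mxE.
by case: i => [[|[|[|[|//]]]] i4]; case: j => [[|[|[|[|//]]]] j4];
  rewrite /= /eq_op/= ?mulr0n ?mulr1n; ring.
Qed.

Lemma gpartial_iphi (R : realType) (n : R) (p : 'rV[R]_4) j l :
  gpartial (taubNUT n) iphi j l p = 0.
Proof.
rewrite /gpartial (@derive_along_line _ _ _ _ _ (cst (taubNUT n p j l)) 0).
  exact: derive_cst.
by move=> h /=; rewrite /taubNUT !mxE/= !mulr0 !add0r.
Qed.

(** Moving along r stays on the equator, so the diagonal form suffices to
compute the derivative, although it holds only there. *)
Lemma gpartial_irad (R : realType) (n : R) (p : 'rV[R]_4) j l :
  p 0 itheta = pi / 2 ->
  gpartial (taubNUT n) irad j l p =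
    'D_1 (fun r => equator_metric n r 0 j *+ (j == l)) (p 0 irad).
Proof.
move=> pth; apply: derive_along_line => h.
by rewrite taubNUT_equator !mxE/= ?eqxx ?mulr0 ?add0r.
Qed.

(** As the metric is diagonal, raising the index k only divides by the k-th
entry. *)
Lemma christoffel_equator (R : realType) (n : R) (p : 'rV[R]_4) k i j :
  n ^+ 2 < p 0 irad ^+ 2 -> p 0 itheta = pi / 2 ->
  christoffel (taubNUT n) k i j p =
  2^-1 * (equator_metric n (p 0 irad) 0 k)^-1 *
    (gpartial (taubNUT n) i j k p + gpartial (taubNUT n) j i k p
     - gpartial (taubNUT n) k i j p).
Proof.
move=> pn pth; rewrite /christoffel taubNUT_equator// invmx_diag; last first.
  have : (p 0 irad - n) * (p 0 irad + n) != 0.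
    by rewrite -subr_sqr subr_eq0 gt_eqF.
  rewrite mulf_eq0 negb_or => /andP[m0 p0].
  by move=> [[|[|[|[|//]]]] i4];
    rewrite mxE/= ?mulf_neq0 ?invr_eq0// subr_eq0 gt_eqF.
rewrite (bigD1 k)//= big1 => [|l lk]; last first.
  by rewrite !mxE eq_sym (negbTE lk) mul0r.
by rewrite !mxE eqxx mulr1n addr0 mulrA.
Qed.

(** Only the Christoffel symbols with lower indices among r and phi occur,
because tau and theta have zero velocity; they involve no theta-derivative of the
metric, the one derivative that the diagonal form does not give. The two
equations are the r and phi components, solved for the accelerations. *)
Lemma equator_geodesic_eqs (R : realType) (n : R) (x : R -> 'rV[R]_4)
    (J : set R) tau0 s :
  open J -> is_geodesic (taubNUT n) x J ->
  (forall s, J s -> taubNUT_chart n (x s)) ->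
  (forall s, J s -> curve_coord x itheta s = pi / 2) ->
  (forall s, J s -> curve_coord x itau s = tau0) -> J s ->
  let r := curve_coord x irad in let ph := curve_coord x iphi in
  [/\ is_derive s 1 r (derive1 r s),
      is_derive s 1 (derive1 r) (n / (r s ^+ 2 - n ^+ 2) * derive1 r s ^+ 2
        + r s * (r s - n) / (r s + n) * derive1 ph s ^+ 2),
      is_derive s 1 ph (derive1 ph s) &
      is_derive s 1 (derive1 ph)
        (- (2 * r s / (r s ^+ 2 - n ^+ 2)) * derive1 r s * derive1 ph s)].
Proof.
move=> Jo geo chart thE tauE Js r ph.
have cst0 k c : (forall s, J s -> curve_coord x k s = c) ->
    derive1 (curve_coord x k) s = 0.
  move=> kc; rewrite derive1E (@near_eq_derive _ _ _ _ (cst c)) ?derive_cst//.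
  by near=> y; apply: kc; near: y; exact: open_nbhs_nbhs.
have th'0 := cst0 _ _ thE; have tau'0 := cst0 _ _ tauE.
have [rn _] := chart s Js; have th0 := thE s Js.
have rn0 : (r s - n) * (r s + n) != 0.
  by rewrite -subr_sqr subr_eq0 gt_eqF.
have rn1 : r s ^+ 2 - n ^+ 2 != 0 by rewrite subr_sqr.
move: (rn0); rewrite mulf_eq0 negb_or => /andP[rmn rpn].
have Drr : 'D_1 (fun r : R => (r + n) / (r - n)) (r s) =
    - (2 * n) / (r s - n) ^+ 2.
  by rewrite derive_val /GRing.scale/=; field.
have Dpp : 'D_1 (fun r : R => r ^+ 2 - n ^+ 2) (r s) = 2 * r s.
  by rewrite derive_val /GRing.scale/=; ring.
have D_rad j l : gpartial (taubNUT n) irad j l (x s) =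
    'D_1 (fun r : R => equator_metric n r 0 j *+ (j == l)) (r s).
  exact: gpartial_irad.
have D_rr : gpartial (taubNUT n) irad irad irad (x s) =
    - (2 * n) / (r s - n) ^+ 2.
  by rewrite D_rad -Drr; apply: near_eq_derive; near=> y; rewrite mxE.
have D_pp : gpartial (taubNUT n) irad iphi iphi (x s) = 2 * r s.
  by rewrite D_rad -Dpp; apply: near_eq_derive; near=> y; rewrite mxE.
have D_ne j l : j != l -> gpartial (taubNUT n) irad j l (x s) = 0.
  by move=> /negbTE jl; rewrite D_rad jl; exact: derive_cst.
have chris k i j := @christoffel_equator R n (x s) k i j rn th0.
have E k := geo s Js k; split.
- by have [/derivableP + _ _] := E irad; rewrite -derive1E.
- have [_ /derivableP + ] := E irad; rewrite -derive1E.
  rewrite !sum_coords -/r -/ph th'0 tau'0 !mulr0 !mul0r !add0r !addr0 !chris.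
  rewrite !gpartial_iphi D_rr D_pp !D_ne// /equator_metric.
  rewrite !mxE/= (_ : x s 0 irad = r s)// => Hr H.
  apply: is_derive_eq Hr _.
  move/eqP: H; rewrite addr_eq0 => /eqP->; field.
  by apply/and3P.
- by have [/derivableP + _ _] := E iphi; rewrite -derive1E.
- have [_ /derivableP + ] := E iphi; rewrite -derive1E.
  rewrite !sum_coords -/r -/ph th'0 tau'0 !mulr0 !mul0r !add0r !addr0 !chris.
  rewrite !gpartial_iphi D_pp !D_ne// /equator_metric.
  rewrite !mxE/= (_ : x s 0 irad = r s)// => Hr H.
  apply: is_derive_eq Hr _.
  by move/eqP: H; rewrite addr_eq0 => /eqP->; field.
Unshelve. all: end_near.
Qed.

(** * First integrals *)

(** The momentum conjugate to phi, conserved because the metric does not depend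
on phi. *)
Lemma angular_momentum_cst (R : realType) (n : R) (r w u : R -> R) (J : set R) :
  is_interval J -> (forall s, J s -> n ^+ 2 < r s ^+ 2) ->
  (forall s, J s -> is_derive s 1 r (u s)) ->
  (forall s, J s -> is_derive s 1 w
     (- (2 * r s / (r s ^+ 2 - n ^+ 2)) * u s * w s)) ->
  forall s t, J s -> J t ->
    (r s ^+ 2 - n ^+ 2) * w s = (r t ^+ 2 - n ^+ 2) * w t.
Proof.
move=> Jitv rn r' w'; apply: is_derive0_cst => // s Js.
have := r' s Js; have := w' s Js => ? ?; apply: is_derive_eq.
have : r s ^+ 2 - n ^+ 2 != 0 by rewrite subr_eq0 gt_eqF// rn.
by rewrite /GRing.scale/= => ?; field.
Qed.

(** The squared speed of a curve with theta = pi/2 and tau constant, which every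
geodesic preserves. *)
Lemma energy_cst (R : realType) (n : R) (r w u : R -> R) (J : set R) :
  is_interval J -> (forall s, J s -> n ^+ 2 < r s ^+ 2) ->
  (forall s, J s -> is_derive s 1 r (u s)) ->
  (forall s, J s -> is_derive s 1 u
     (n / (r s ^+ 2 - n ^+ 2) * u s ^+ 2
      + r s * (r s - n) / (r s + n) * w s ^+ 2)) ->
  (forall s, J s -> is_derive s 1 w
     (- (2 * r s / (r s ^+ 2 - n ^+ 2)) * u s * w s)) ->
  forall s t, J s -> J t ->
    (r s + n) / (r s - n) * u s ^+ 2 + (r s ^+ 2 - n ^+ 2) * w s ^+ 2 =
    (r t + n) / (r t - n) * u t ^+ 2 + (r t ^+ 2 - n ^+ 2) * w t ^+ 2.
Proof.
move=> Jitv rn r' u' w'.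
apply: (@is_derive0_cst _ J (fun s => (r s + n) / (r s - n) * u s ^+ 2
  + (r s ^+ 2 - n ^+ 2) * w s ^+ 2)) => // s Js.
have := r' s Js; have := w' s Js; have := u' s Js => ? ? ?.
have : r s ^+ 2 - n ^+ 2 != 0 by rewrite subr_eq0 gt_eqF// rn.
move=> rn0; move: (rn0); rewrite subr_sqr mulf_eq0 negb_or => /andP[rm rp].
apply: is_derive_eq.
rewrite /GRing.scale/=; field.
by apply/and3P.
Qed.

(** * The primitives and their values at the turning point *)

Definition radial_root (R : realType) (m r : R) := Num.sqrt (r ^+ 2 - m ^+ 2).

Definition time_primitive (R : realType) (n m r : R) :=
  radial_root m r + n * ln (r + radial_root m r).

Definition angle_primitive (R : realType) (n m r1 phi0 r : R) :=
  atan (r1 * (r * n - m ^+ 2) / (phi0 * radial_root m r)).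

Lemma radial_root_gt0 (R : realType) (m r : R) :
  m ^+ 2 < r ^+ 2 -> 0 < radial_root m r.
Proof. by move=> mr; rewrite sqrtr_gt0 subr_gt0. Qed.

Lemma sqr_radial_root (R : realType) (m r : R) :
  m ^+ 2 < r ^+ 2 -> radial_root m r ^+ 2 = r ^+ 2 - m ^+ 2.
Proof. by move=> mr; rewrite sqr_sqrtr// subr_ge0 ltW. Qed.

Lemma is_derive_radial_root (R : realType) (m r : R) : m ^+ 2 < r ^+ 2 ->
  is_derive r 1 (@radial_root R m) (r / radial_root m r).
Proof.
move=> mr; have S0 := radial_root_gt0 mr.
have H : is_derive (r ^+ 2 - m ^+ 2) 1 Num.sqrt (2 * radial_root m r)^-1.
  by apply: is_derive1_sqrt; rewrite subr_gt0.
have H2 : is_derive r 1 (fun r : R => r ^+ 2 - m ^+ 2) (2 * r).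
  by apply: is_derive_eq; rewrite /GRing.scale/=; ring.
have H3 : is_derive r 1 (@radial_root R m) _ :=
  @is_derive1_comp _ _ (fun r : R => r ^+ 2 - m ^+ 2) _ _ _ H H2.
apply: is_derive_eq H3 _.
by field; rewrite gt_eqF.
Qed.

(** When n = 0 the logarithm disappears, and r is allowed to be negative. *)
Lemma is_derive_time_primitive (R : realType) (n m r : R) :
  m ^+ 2 < r ^+ 2 -> (n = 0 \/ 0 < r) ->
  is_derive r 1 (time_primitive n m) ((r + n) / radial_root m r).
Proof.
move=> mr r0; have S0 := radial_root_gt0 mr.
have S' := is_derive_radial_root mr.
case: r0 => [->|r0].
  rewrite addr0; have -> // : time_primitive 0 m = @radial_root R m.
  by apply/funext => y; rewrite /time_primitive mul0r addr0.
have rS : 0 < r + radial_root m r by rewrite addr_gt0.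
have L := @is_derive1_comp _ _ (id + @radial_root R m) _ _ _
  (is_derive1_ln rS) (is_deriveD (is_derive_id r 1) S').
have H := is_deriveD S' (is_deriveZ n L).
have {}H : is_derive r 1 (time_primitive n m) _ := H.
apply: is_derive_eq H _.
by rewrite /GRing.scale/=; field; rewrite !gt_eqF.
Qed.

(** The relation between phi0, r1 and m makes the sum of 1 and the square of the
argument of the arctangent a perfect square, namely
(r1 m (r - n) / (phi0 sqrt (r^2 - m^2)))^2; the derivative then simplifies. *)
Lemma is_derive_angle_primitive (R : realType) (n m r1 phi0 r : R) :
  r1 != 0 -> phi0 != 0 -> phi0 ^+ 2 = r1 ^+ 2 * (m ^+ 2 - n ^+ 2) ->
  m ^+ 2 < r ^+ 2 ->
  is_derive r 1 (angle_primitive n m r1 phi0)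
    (phi0 / (r1 * radial_root m r * (r - n))).
Proof.
move=> r10 phi00 phi0E mr.
have S0 := radial_root_gt0 mr; have S' := is_derive_radial_root mr.
have S2 := sqr_radial_root mr.
have S00 : radial_root m r != 0 by rewrite gt_eqF.
have D0 : phi0 * radial_root m r != 0 by rewrite mulf_neq0.
pose u r := r1 * (r * n - m ^+ 2) / (phi0 * radial_root m r).
have nm : n ^+ 2 < m ^+ 2.
  have : 0 < r1 ^+ 2 * (m ^+ 2 - n ^+ 2) by rewrite -phi0E exprn_even_gt0.
  by rewrite pmulr_rgt0 ?exprn_even_gt0// subr_gt0.
have m0 : m != 0.
  by apply: contraTneq nm => ->; rewrite expr0n/= -leNgt sqr_ge0.
have rn0 : r - n != 0.
  by rewrite subr_eq0; apply: contraTneq (lt_trans nm mr) => ->; rewrite ltxx.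
have u2 : 1 + u r ^+ 2 =
    (r1 * m * (r - n)) ^+ 2 / (phi0 * radial_root m r) ^+ 2.
  rewrite /u expr_div_n; apply: (mulIf (expf_neq0 2 D0)).
  rewrite mulrDl mul1r !divfK ?expf_neq0// exprMn S2 phi0E; ring.
have du : is_derive r 1 u
    (r1 * m ^+ 2 * (r - n) / (phi0 * radial_root m r ^+ 3)).
  have Dn : is_derive r 1 (fun r : R => r1 * (r * n - m ^+ 2)) (r1 * n).
    by apply: is_derive_eq; rewrite /GRing.scale/=; ring.
  have Dd : is_derive r 1 (fun r : R => (phi0 * radial_root m r)^-1)
      (- (phi0 * radial_root m r) ^- 2 * (phi0 * (r / radial_root m r))).
    by apply: is_deriveV => //; apply: is_derive_eq;
      rewrite /GRing.scale/= mulr0 addr0.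
  apply: is_derive_eq (is_deriveM Dn Dd) _.
  rewrite /GRing.scale/=.
  have -> : m ^+ 2 = r ^+ 2 - radial_root m r ^+ 2 by rewrite S2; ring.
  by field; rewrite ?S00 ?phi00 ?D0.
apply: is_derive_eq (@is_derive1_comp _ _ u _ _ _ (is_derive1_atan (u r)) du) _.
rewrite u2.
by field; rewrite ?S00 ?phi00 ?D0 ?r10 ?rn0 ?m0.
Qed.

(** This is how the boundary conditions give the values of quantities that are
conserved along the geodesic. *)
Lemma cvg_within_cst (R : realType) (A : set R) (F : set_system R)
    (f : R -> R) (c l : R) :
  ProperFilter (within A F) -> Filter F ->
  (forall r, A r -> f r = c) -> f r @[r --> within A F] --> l -> l = c.
Proof.
move=> PF FF fc fl; apply/esym; apply: norm_cvg_unique fl.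
have cc : c @[_ --> within A F] --> c by exact: cvg_cst.
apply: cvg_trans cc; apply: near_eq_cvg.
by apply: filterS (withinT A FF) => r Ar; rewrite fc.
Qed.

Lemma continuous_radial_root (R : realType) (m : R) : continuous (@radial_root R m).
Proof.
move=> r; apply: (@continuous_comp _ _ _ (fun r : R => r ^+ 2 - m ^+ 2)).
  by apply: cvgB; [exact: exprn_continuous|exact: cvg_cst].
exact: sqrt_continuous.
Qed.

Lemma radial_root_id (R : realType) (m : R) : radial_root m m = 0.
Proof. by rewrite /radial_root subrr sqrtr0. Qed.

Lemma cvg_time_primitive (R : realType) (n m : R) :
  n = 0 \/ 0 < m -> time_primitive n m r @[r --> m] --> n * ln m.
Proof.
have S := @continuous_radial_root _ m m.
move=> nm; rewrite -[n * ln m]add0r -{1}(radial_root_id m).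
apply: cvgD => //; case: nm => [->|m0].
  rewrite mul0r; under eq_fun do rewrite mul0r; exact: cvg_cst.
apply: cvgMr.
have SD : r + radial_root m r @[r --> m] --> m + radial_root m m.
  by apply: cvgD => //; exact: cvg_id.
rewrite radial_root_id addr0 in SD.
exact: cvg_comp SD (continuous_ln m0).
Qed.

(** The argument of the arctangent tends to infinity, with the sign opposite to
that of r1 phi0 because m n < m^2; its inverse is continuous at m, where it
vanishes. *)
Lemma cvg_angle_primitive (R : realType) (n m r1 phi0 : R) :
  r1 != 0 -> phi0 != 0 -> `|n| < m ->
  angle_primitive n m r1 phi0 r @[r --> m^'+] -->
    - (Num.sg (r1 * phi0) * (pi / 2)).
Proof.
move=> r10 phi00 nm.
(* The inverse of the argument of the arctangent. *)
pose v r := phi0 * radial_root m r / (r1 * (r * n - m ^+ 2)).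
have m0 : 0 < m := le_lt_trans (normr_ge0 n) nm.
have N0 : m * n - m ^+ 2 < 0.
  rewrite expr2 -mulrBr pmulr_rlt0// subr_lt0.
  by apply: le_lt_trans nm; exact: ler_norm.
have Nc : r * n - m ^+ 2 @[r --> m] --> m * n - m ^+ 2.
  by apply: cvgB; [apply: cvgMl; exact: cvg_id|exact: cvg_cst].
have N_lt0 : \forall r \near m^'+, r * n - m ^+ 2 < 0.
  exact: (cvgr_lt _ (cvg_at_right_filter Nc) _ N0).
have vc : v r @[r --> m] --> 0.
  have -> : 0 = v m by rewrite /v radial_root_id mulr0 mul0r.
  apply: cvgM; first by apply: cvgMr; exact: continuous_radial_root.
  by apply: cvgV; [rewrite mulf_neq0// lt_eqF|exact: cvgMr].
have avc : - (Num.sg (r1 * phi0) * (pi / 2)) - atan (v r) @[r --> m^'+] -->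
    - (Num.sg (r1 * phi0) * (pi / 2)).
  rewrite -[X in _ --> X]subr0 -(atan0 R); apply: cvgB; first exact: cvg_cst.
  apply: cvg_at_right_filter.
  exact: (continuous_cvg _ (@continuous_atan _ _) vc).
apply: cvg_trans avc; apply: near_eq_cvg; near=> r.
have mr : m < r by near: r; exact: nbhs_right_gt.
have S0 : 0 < radial_root m r.
  by apply: radial_root_gt0; rewrite ltr_pXn2r// nnegrE ltW// (lt_trans m0).
have Nr : r * n - m ^+ 2 < 0.
  by near: r; exact: N_lt0.
apply/esym; rewrite [LHS]atanV; last first.
  by rewrite mulf_neq0 ?invr_eq0 ?mulf_neq0 ?(lt_eqF Nr) ?(gt_eqF S0).
rewrite invf_div; congr (_ - _).
rewrite !sgrM sgrV sgrM (gtr0_sg S0) (ltr0_sg Nr).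
ring.
Unshelve. all: end_near. Qed.

Lemma angle_primitive0 (R : realType) (n m r1 r : R) :
  angle_primitive n m r1 0 r = 0.
Proof. by rewrite /angle_primitive mul0r invr0 mulr0 atan0. Qed.

(** * Quadrature *)

(** The radial equation fixes r' up to a sign epsilon that is constant along the
interval, and the two differences below have zero derivative. *)
Lemma equator_quadratures (R : realType) (n m r1 phi0 : R) (J : set R)
    (r u u' phi w : R -> R) :
  is_interval J -> r1 != 0 -> phi0 ^+ 2 = r1 ^+ 2 * (m ^+ 2 - n ^+ 2) ->
  (forall s, J s -> n ^+ 2 < r s ^+ 2) ->
  (forall s, J s -> m ^+ 2 < r s ^+ 2) ->
  n = 0 \/ (forall s, J s -> 0 < r s) ->
  (forall s, J s -> is_derive s 1 r (u s)) ->
  (forall s, J s -> is_derive s 1 u (u' s)) ->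
  (forall s, J s -> is_derive s 1 phi (w s)) ->
  (forall s, J s -> (r s ^+ 2 - n ^+ 2) * w s = phi0) ->
  (forall s, J s ->
     (u s * (r s + n)) ^+ 2 = r1 ^+ 2 * (r s ^+ 2 - m ^+ 2)) ->
  exists e : R, (e = 1 \/ e = -1) /\ forall s t, J s -> J t ->
    s - e / r1 * time_primitive n m (r s) =
      t - e / r1 * time_primitive n m (r t) /\
    phi s - e * angle_primitive n m r1 phi0 (r s) =
      phi t - e * angle_primitive n m r1 phi0 (r t).
Proof.
move=> Jitv r10 phi0E rn rm rpos r' du phi' wE uE.
pose S s : R := radial_root m (r s).
have S0 s : J s -> S s != 0 by move=> /rm /radial_root_gt0 ?; rewrite gt_eqF.
have S2 s : J s -> S s ^+ 2 = r s ^+ 2 - m ^+ 2.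
  by move=> /rm; exact: sqr_radial_root.
(* The square of q is r1 ^+ 2 by the radial equation; q / r1 is the sign. *)
pose q s := u s * (r s + n) / S s.
have q' s : J s -> is_derive s 1 q ('D_1 q s).
  move=> Js; have ? := r' s Js; have ? := du s Js.
  have S' : is_derive s 1 S _ :=
    @is_derive1_comp _ _ r _ _ _ (is_derive_radial_root (rm s Js)) (r' s Js).
  have ? := is_deriveV (S0 s Js) S'.
  by apply: derivableP; rewrite /q; exact: ex_derive.
have [e [e1 qE]] : exists e : R,
    (e = 1 \/ e = -1) /\ forall s, J s -> q s = e * r1.
  apply: sqr_cst_sign q' r10 _ => // s Js.
  by rewrite expr_div_n uE// -(S2 s Js) mulfK// expf_neq0// S0.
have ee : e * e = 1 by case: e1 => ->; rewrite ?mulrNN mulr1.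
exists e; split => // s t Js Jt.
have rn0 y : J y -> (r y + n != 0) * (r y - n != 0).
  move=> /rn; rewrite -subr_gt0 => /lt0r_neq0.
  by rewrite subr_sqr mulf_eq0 negb_or => /andP[-> ->].
have uq y : J y -> u y = e * r1 * S y / (r y + n).
  by move=> Jy; rewrite -(qE y Jy) /q divfK ?S0// mulfK// rn0.
split.
- apply: (@is_derive0_cst _ J
    (fun s => s - e / r1 * time_primitive n m (r s))) => // y Jy.
  have ry : n = 0 \/ 0 < r y by case: rpos => [|/(_ y Jy)]; [left|right].
  have T' := @is_derive1_comp _ _ r _ _ _
    (is_derive_time_primitive (rm y Jy) ry) (r' y Jy).
  have H := is_deriveB (is_derive_id y 1) (is_deriveZ (e / r1) T').
  apply: (is_derive_eq H); rewrite /GRing.scale/= uq//.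
  have [rp _] := rn0 y Jy; have Sy := S0 y Jy.
  rewrite [X in _ - X](_ : _ = e * e); first by rewrite ee subrr.
  by rewrite /S in Sy *; field; rewrite rp r10 Sy.
have [phi00|phi00] := eqVneq phi0 0.
  rewrite phi00 !angle_primitive0 mulr0 !subr0.
  apply: (@is_derive0_cst _ J phi) => // y Jy.
  apply: is_derive_eq (phi' y Jy) _.
  apply/eqP; have /eqP := wE y Jy.
  by rewrite phi00 mulf_eq0 subr_eq0 gt_eqF// rn.
apply: (@is_derive0_cst _ J
  (fun s => phi s - e * angle_primitive n m r1 phi0 (r s))) => // y Jy.
have A' := @is_derive1_comp _ _ r _ _ _
  (is_derive_angle_primitive r10 phi00 phi0E (rm y Jy)) (r' y Jy).
have H := is_deriveB (phi' y Jy) (is_deriveZ e A').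
apply: (is_derive_eq H); rewrite /GRing.scale/= uq//.
have [rp rm0] := rn0 y Jy; have Sy := S0 y Jy.
have rn2 : r y ^+ 2 - n ^+ 2 != 0 by rewrite subr_sqr mulf_neq0.
have -> : w y = e * e * (phi0 / (r y ^+ 2 - n ^+ 2)).
  by rewrite ee mul1r -(wE y Jy) mulrAC divff// mul1r.
by rewrite /S in Sy *; field; rewrite rp rm0 r10 Sy rn2.
Qed.

(** * The theorem *)

Unset Implicit Arguments.

(* The terms n * ln R2 and Num.sg (r1 * phi0) * (pi / 2) are boundary values at
   R2: with them the right-hand sides tend to t1 and phi1. *)
Theorem theorem3p3 (R : realType) (n r1 phi0 t1 phi1 tau0 : R)
    (x : R -> 'rV[R]_4) (J : set R) (tt ph : R -> R) :
  let R2 : R := Num.sqrt (n ^+ 2 + phi0 ^+ 2 / r1 ^+ 2) in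
  let I := curve_coord x irad @` J in
  let F := within I R2^' in
  r1 != 0 ->
  open J -> is_interval J ->
  (forall s, J s -> taubNUT_chart n (x s)) ->
  is_geodesic (taubNUT n) x J ->
  (forall s, J s -> curve_coord x itheta s = pi / 2) ->
  (forall s, J s -> curve_coord x itau s = tau0) ->
  (forall s, J s -> tt (curve_coord x irad s) = s) ->
  (forall s, J s -> ph (curve_coord x irad s) = curve_coord x iphi s) ->
  limit_point I R2 ->
  tt r @[r --> F] --> t1 ->
  ph r @[r --> F] --> phi1 ->
  (r ^+ 2 - n ^+ 2) * derive1 (curve_coord x iphi) (tt r) @[r --> F] --> phi0 ->
  (r + n) / (r - n) * derive1 (curve_coord x irad) (tt r) ^+ 2
    + phi0 ^+ 2 / (r ^+ 2 - n ^+ 2) @[r --> F] --> r1 ^+ 2 ->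
  exists epsilon : R, (epsilon = 1 \/ epsilon = -1) /\
    forall r, I r ->
      tt r = t1 + epsilon / r1 *
        ((Num.sqrt (r ^+ 2 - R2 ^+ 2)
          + n * ln (r + Num.sqrt (r ^+ 2 - R2 ^+ 2))) - n * ln R2) /\
      ph r = phi1 + epsilon *
        (atan (r1 * (r * n - R2 ^+ 2)
               / (phi0 * Num.sqrt (r ^+ 2 - R2 ^+ 2)))
         + Num.sg (r1 * phi0) * (pi / 2)).
Proof.
move=> m I F r10 Jo Jitv chart geo thE tauE ttE phE limI ttl phl momentum energy.
set r := curve_coord x irad in I F ttE phE limI ttl phl momentum energy *.
set phi := curve_coord x iphi in phE momentum.
pose u := derive1 r; pose w := derive1 phi.
have PF : ProperFilter F := within_limit_point_proper limI.
have odes s (Js : J s) := equator_geodesic_eqs Jo geo chart thE tauE Js.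
have r' s : J s -> is_derive s 1 r (u s) by move=> /odes[].
have u' s : J s -> is_derive s 1 u (n / (r s ^+ 2 - n ^+ 2) * u s ^+ 2
    + r s * (r s - n) / (r s + n) * w s ^+ 2) by move=> /odes[].
have phi' s : J s -> is_derive s 1 phi (w s) by move=> /odes[].
have w' s : J s -> is_derive s 1 w
    (- (2 * r s / (r s ^+ 2 - n ^+ 2)) * u s * w s) by move=> /odes[].
have rn s : J s -> n ^+ 2 < r s ^+ 2 by move=> /chart[].
have m2 : m ^+ 2 = n ^+ 2 + phi0 ^+ 2 / r1 ^+ 2.
  by rewrite sqr_sqrtr// addr_ge0 ?divr_ge0// sqr_ge0.
have phi0E : phi0 ^+ 2 = r1 ^+ 2 * (m ^+ 2 - n ^+ 2).
  by rewrite m2; field.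
have m_ge0 : 0 <= m := sqrtr_ge0 _.
(* A function of the radius that is constant along the curve equals its limit
   at the turning radius. *)
have lim_cst (f : R -> R) (g : R -> R) l : (forall s, J s -> f (r s) = g s) ->
    (forall s t, J s -> J t -> g s = g t) -> f y @[y --> F] --> l ->
    forall s, J s -> g s = l.
  move=> fg gcst fl s Js; apply/esym; apply: cvg_within_cst fl => _ [y Jy <-].
  by rewrite fg//; exact: gcst.
have wE s : J s -> (r s ^+ 2 - n ^+ 2) * w s = phi0.
  move: s; apply: lim_cst momentum; first by move=> s Js; rewrite ttE.
  exact: angular_momentum_cst r' w'.
have rn0 s : J s -> [/\ r s ^+ 2 - n ^+ 2 != 0, r s - n != 0 & r s + n != 0].
  move=> /rn; rewrite -subr_gt0 => /lt0r_neq0 H; split => //; move: H;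
  by rewrite subr_sqr mulf_eq0 negb_or => /andP[].
have uE s : J s -> (u s * (r s + n)) ^+ 2 = r1 ^+ 2 * (r s ^+ 2 - m ^+ 2).
  move=> Js; have [rn1 rn2 rn3] := rn0 s Js.
  have : (r s + n) / (r s - n) * u s ^+ 2
      + (r s ^+ 2 - n ^+ 2) * w s ^+ 2 = r1 ^+ 2.
    move: s Js {rn1 rn2 rn3}; apply: lim_cst energy; last first.
      exact: energy_cst r' u' w'.
    move=> s Js; have [rn1 rn2 rn3] := rn0 s Js.
    by rewrite ttE// -(wE s Js) -/u -/w; congr (_ + _); field.
  move=> E.
  rewrite (_ : _ * (_ - _) = r1 ^+ 2 * (r s ^+ 2 - n ^+ 2) - phi0 ^+ 2).
    by rewrite -E -(wE s Js); field.
  by rewrite phi0E; ring.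
(* If the turning radius is 0 then n = 0, and the chart only says r != 0. *)
have n0m : n = 0 \/ 0 < m.
  have [m0|m0] := eqVneq m 0; last by right; rewrite lt_neqAle eq_sym m0.
  left; apply/eqP; move/eqP: m2; rewrite m0 expr0n/= eq_sym.
  by rewrite paddr_eq0 ?divr_ge0 ?sqr_ge0// sqrf_eq0 => /andP[].
have rpos : 0 < m -> forall s, J s -> 0 < r s.
  (* The ball of radius m around m contains only positive radii. *)
  move=> m0; have [_ [_ [s1 Js1 <-]]] := limI _ (nbhsx_ballx m m m0).
  rewrite /ball/= ltr_norml => /andP[_ rs1] s Js.
  apply: (interval_nonzero_gt0 Jitv r' _ Js1 Js); last by lra.
  move=> z /rn; apply: contraTneq => ->.
  by rewrite expr0n/= -leNgt sqr_ge0.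
have rm s : J s -> m ^+ 2 < r s ^+ 2.
  have [m0|m0] := eqVneq m 0.
    case: n0m => [n0|]; last by rewrite m0 ltxx.
    by move/rn; rewrite n0 m0.
  have {}m0 : 0 < m by rewrite lt_neqAle eq_sym m0.
  move=> Js; rewrite ltr_pXn2r// ?nnegrE ?(ltW m0) ?(ltW (rpos m0 s Js))//.
  apply: inj_no_interior_min r' _ _ _ Js => //.
    by move=> a b Ja Jb rab; rewrite -(ttE a Ja) rab ttE.
  move=> a Ja; rewrite -(@ler_pXn2r _ 2)// ?nnegrE ?(ltW (rpos m0 a Ja))//.
  rewrite -subr_ge0 -(@pmulr_rge0 _ (r1 ^+ 2)) ?exprn_even_gt0//.
  by rewrite -uE// sqr_ge0.
have nrpos : n = 0 \/ forall s, J s -> 0 < r s.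
  by case: n0m => [|/rpos]; [left|right].
have [e [e1 eE]] :=
  equator_quadratures Jitv r10 phi0E rn rm nrpos r' u' phi' wE uE.
exists e; split => // _ [s Js <-]; split.
- have Tl : tt y - e / r1 * time_primitive n m y @[y --> F]
      --> t1 - e / r1 * (n * ln m).
    apply: cvgB ttl _; apply: cvgMr.
    apply: cvg_within_filter; apply: cvg_trans (cvg_time_primitive n0m).
    by apply: cvg_app; exact: cvg_within.
  have :=
    lim_cst _ (fun s => s - e / r1 * time_primitive n m (r s)) _ _ _ Tl s Js.
  rewrite ttE// => H.
  rewrite -[LHS](subrK (e / r1 * time_primitive n m (r s))) H.
  + by rewrite /time_primitive /radial_root; ring.
  + by move=> a Ja; rewrite ttE.
  + by move=> a b Ja Jb; have [] := eE a b Ja Jb.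
rewrite phE//.
have Al : ph y - e * angle_primitive n m r1 phi0 y @[y --> F]
    --> phi1 + e * (Num.sg (r1 * phi0) * (pi / 2)).
  rewrite -[X in phi1 + X]opprK -mulrN.
  apply: cvgB phl _; apply: cvgMr.
  have [phi00|phi00] := eqVneq phi0 0.
    rewrite phi00 mulr0 sgr0 mul0r oppr0.
    rewrite (funext (@angle_primitive0 R n m r1)).
    exact: cvg_cst.
  have nm : `|n| < m.
    rewrite -(@ltr_pXn2r _ 2)// ?nnegrE// real_normK ?num_real// m2.
    by rewrite ltrDl divr_gt0// exprn_even_gt0.
  have m0 : 0 < m by apply: le_lt_trans nm.
  (* The radius is greater than m, so it tends to m from the right. *)
  apply: cvg_trans (cvg_angle_primitive r10 phi00 nm).
  apply: cvg_app => A mA.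
  have {mA} : nbhs m (fun y => m < y -> A y) := mA.
  apply: filterS => y mA _ [a Ja ay]; apply: mA.
  rewrite -ay -(@ltr_pXn2r _ 2)// ?nnegrE ?(ltW m0) ?(ltW (rpos m0 a Ja))//.
  exact: rm.
have := lim_cst _ (fun s => phi s - e * angle_primitive n m r1 phi0 (r s))
  _ _ _ Al s Js.
move=> H; rewrite -[LHS](subrK (e * angle_primitive n m r1 phi0 (r s))) H.
- by rewrite /angle_primitive /radial_root; ring.
- by move=> a Ja; rewrite phE.
- by move=> a b Ja Jb; have [] := eE a b Ja Jb.
Qed.
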